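(* Let $\delta\in(0,1)$ and $t_n=n^{\delta/2}$. Assume the random vector $\theta\in\mathbb{R}^n$ satisfies $\theta\sim\mathrm{DL}_a(\tau)$ with $a=1/n$ and $\tau\sim\mathrm{Exp}(\lambda)$ for some $\lambda>0$. Also assume $\theta_0\in\mathbb{R}^n$ has only one non-zero entry and $\|\theta_0\|_2^2=c\log n$, with $c$ a constant. Then, for a constant $C$ depending only on $\delta$ and $\lambda$, $$\mathbb{P}(\|\theta-\theta_0\|_2<t_n)\ge\exp\{-C\sqrt{\log n}\}.$$
   Context: $\|\cdot\|_2$ is the Euclidean norm. $\mathrm{DE}(\sigma)$ denotes the Laplace distribution with density $(2\sigma)^{-1}e^{-|y|/\sigma}$ on $\mathbb{R}$. The Dirichlet–Laplace prior $\mathrm{DL}_a(\tau)$ on $\theta=(\theta_1,\dots,\theta_n)$ is the hierarchical prior: given $\phi$ and $\tau$, $\theta_j\sim\mathrm{DE}(\phi_j\tau)$ independently for $j=1,\dots,n$; $\phi=(\phi_1,\dots,\phi_n)\sim\mathrm{Dir}(a,\dots,a)$ on the simplex $\{\phi_j\ge0,\ \sum_j\phi_j=1\}$, independently of $\tau$; here $\tau\sim\mathrm{Exp}(\lambda)$, the exponential distribution with rate $\lambda$.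
   Formalization: The bound is stated for all n at least a threshold depending on δ, λ and c; without such a threshold it fails with C depending only on δ and λ (fix n=2 and let c grow: the left side tends to 0). *)

(* Defs.v *)
From HB Require Import structures.
From mathcomp Require Import all_boot all_order all_algebra.
From mathcomp Require Import all_classical all_reals all_analysis.

Set Implicit Arguments.
Unset Strict Implicit.
Unset Printing Implicit Defensive.

Import Order.TTheory GRing.Theory Num.Theory.
Import numFieldNormedType.Exports.

Local Open Scope classical_set_scope.
Local Open Scope ring_scope.

Section lebesgue_cons.
Context {R : realType} (n : nat).
Variable m : {sigma_finite_measure set (n.-tuple R) -> \bar R}.

Definition tuple_cons (x : R * n.-tuple R) : n.+1.-tuple R :=
  [tuple of x.1 :: x.2].

Definition tuple_uncons (x : n.+1.-tuple R) : R * n.-tuple R :=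
  (thead x, [tuple of behead x]).

Lemma tuple_uncons_consK : cancel tuple_cons tuple_uncons.
Proof.
by move=> [x t]; rewrite /tuple_uncons/= theadE; congr pair; apply/val_inj.
Qed.

Lemma tuple_cons_unconsK : cancel tuple_uncons tuple_cons.
Proof. by move=> x; apply/val_inj; case/tupleP: x. Qed.

Lemma measurable_tuple_cons : measurable_fun [set: R * n.-tuple R] tuple_cons.
Proof. exact: measurable_cons. Qed.

Lemma measurable_tuple_uncons : measurable_fun [set: n.+1.-tuple R] tuple_uncons.
Proof.
apply/measurable_fun_pairP; split; first exact: measurable_tnth.
exact: measurable_behead.
Qed.

Definition lebesgue_cons : set (n.+1.-tuple R) -> \bar R :=
  pushforward (lebesgue_measure \x m)%E tuple_cons.

HB.instance Definition _ := Measure.copy lebesgue_cons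
  (measure_function_pushforward__canonical__measure_function_Measure
    (lebesgue_measure \x m)%E measurable_tuple_cons).

Lemma sigma_finite_lebesgue_cons : sigma_finite setT lebesgue_cons.
Proof.
have /sigma_finiteP[F [FT Fnd Foo]] :=
  sigma_finiteT (@lebesgue_measure R : {sigma_finite_measure set _ -> \bar R}).
have /sigma_finiteP[G [GT Gnd Goo]] := sigma_finiteT m.
exists (fun k => tuple_uncons @^-1` (F k `*` G k)) => [|k].
  apply/esym/seteqP; split=> // x _.
  have [i _ Fi] : (\bigcup_i F i) (tuple_uncons x).1 by rewrite -FT.
  have [j _ Gj] : (\bigcup_j G j) (tuple_uncons x).2 by rewrite -GT.
  exists (maxn i j) => //; split.
    by move: Fi; exact/subsetPset/Fnd/leq_maxl.
  by move: Gj; exact/subsetPset/Gnd/leq_maxr.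
have [mF Fk] := Foo k; have [mG Gk] := Goo k; split.
  rewrite -[X in measurable X]setTI; apply: measurable_tuple_uncons => //.
  exact: measurableX.
rewrite /lebesgue_cons /pushforward -comp_preimage.
rewrite (_ : _ \o _ = id); last by apply/funext => x; exact: tuple_uncons_consK.
rewrite preimage_id [ltLHS]product_measure1E//.
by rewrite lte_mul_pinfty// ge0_fin_numE.
Qed.

HB.instance Definition _ := Measure_isSigmaFinite.Build _ _ _ lebesgue_cons
  sigma_finite_lebesgue_cons.

End lebesgue_cons.

Fixpoint lebesgue_tuple {R : realType} (n : nat) :
    {sigma_finite_measure set (n.-tuple R) -> \bar R} :=
  match n with
  | 0%N => dirac ([tuple] : 0.-tuple R)
  | n'.+1 => lebesgue_cons (lebesgue_tuple n')
  end.

Section distributions.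
Context {R : realType}.

Definition gamma_fun (a : R) : R :=
  \int[lebesgue_measure]_(x in `]0, +oo[) (x `^ (a - 1) * expR (- x)).

Definition laplace_pdf (sigma y : R) : R :=
  (2 * sigma)^-1 * expR (- `|y| / sigma).

(* DE(sigma) for [sigma > 0]. In the hierarchy below [sigma = phi_j * tau], which
   is positive almost surely, so the values for [sigma <= 0] are irrelevant. *)
Definition laplace_prob (sigma : R) (A : set R) : \bar R :=
  (\int[lebesgue_measure]_(y in A) (laplace_pdf sigma y)%:E)%E.

Definition prob_simplex (n : nat) : set (n.-tuple R) :=
  [set p | (forall j, 0 <= tnth p j) /\ \sum_(j < n) tnth p j = 1].

(* The point of the hyperplane [\sum_j p_j = 1] with given first [n - 1]
   coordinates; the last one is produced by the default value of [nth]. *)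
Definition hyperplane_point (n : nat) (x : n.-1.-tuple R) : n.-tuple R :=
  [tuple nth (1 - \sum_(i < n.-1) tnth x i) x j | j < n].

(* Density with respect to Lebesgue measure in the first [n - 1] coordinates. *)
Definition dirichlet_pdf (n : nat) (a : R) (p : n.-tuple R) : R :=
  gamma_fun (n%:R * a) / gamma_fun a ^+ n * \prod_(j < n) tnth p j `^ (a - 1).

(* The symmetric Dirichlet distribution Dir(a, ..., a), for [n > 0]. *)
Definition dirichlet_prob (n : nat) (a : R) (B : set (n.-tuple R)) : \bar R :=
  (\int[lebesgue_tuple n.-1]_(x in @hyperplane_point n @^-1` (@prob_simplex n `&` B))
    (dirichlet_pdf a (hyperplane_point x))%:E)%E.

End distributions.

Definition independent_RV d d1 d2 (T : measurableType d)
    (T1 : measurableType d1) (T2 : measurableType d2) (R : realType)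
    (P : probability T R) (X : {RV P >-> T1}) (Y : {RV P >-> T2}) : Prop :=
  forall A B, measurable A -> measurable B ->
    (P (X @^-1` A `&` Y @^-1` B) = P (X @^-1` A) * P (Y @^-1` B))%E.

(* Given [(phi, tau)], the [theta_j] are independent with
   [theta_j ~ DE(phi_j * tau)]: the product of Laplace distributions is a
   regular conditional distribution of [theta] given [(phi, tau)]. *)
Definition conditionally_laplace d (T : measurableType d) (R : realType)
    (P : probability T R) (n : nat) (theta phi : {RV P >-> n.-tuple R})
    (tau : {RV P >-> R}) : Prop :=
  forall (A : 'I_n -> set R) (G : set (n.-tuple R * R)),
    (forall j, measurable (A j)) -> measurable G ->
    P ([set w | forall j, A j (tnth (theta w) j)] `&`
       [set w | G (phi w, tau w)])
    = (\int[P]_(w in [set w | G (phi w, tau w)])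
         \prod_(j < n) laplace_prob (tnth (phi w) j * tau w) (A j))%E.

Definition DL_hierarchy d (T : measurableType d) (R : realType)
    (P : probability T R) (n : nat) (a lambda : R)
    (theta phi : {RV P >-> n.-tuple R}) (tau : {RV P >-> R}) : Prop :=
  [/\ forall S, measurable S -> distribution P tau S = exponential_prob lambda S,
      forall B, measurable B -> distribution P phi B = dirichlet_prob a B,
      independent_RV phi tau
    & conditionally_laplace theta phi tau].

(* [theta ~ DL_a(tau)] with [tau ~ Exp(lambda)] is a property of the law of
   [theta] only, so [phi] and [tau] may live on another probability space. *)
Definition DL_distributed d (T : measurableType d) (R : realType)
    (P : probability T R) (n : nat) (a lambda : R)
    (theta : {RV P >-> n.-tuple R}) : Prop :=
  exists d' (T' : measurableType d') (P' : probability T' R)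
    (theta' phi : {RV P' >-> n.-tuple R}) (tau : {RV P' >-> R}),
    DL_hierarchy a lambda theta' phi tau /\
    forall B, measurable B -> distribution P theta B = distribution P' theta' B.

Definition norm2 (R : realType) (n : nat) (x : 'I_n -> R) : R :=
  Num.sqrt (\sum_(j < n) x j ^+ 2).

(* Main.v *)
Require Import Defs.
From HB Require Import structures.
From mathcomp Require Import all_boot all_order all_algebra.
From mathcomp Require Import all_classical all_reals all_analysis.
From mathcomp Require Import measurable_realfun.
From mathcomp Require Import ring lra.
Set Implicit Arguments.
Unset Strict Implicit.
Unset Printing Implicit Defensive.
Import Order.TTheory GRing.Theory Num.Theory.
Import numFieldNormedType.Exports.
Local Open Scope classical_set_scope.
Local Open Scope ring_scope.

(** Conditionally on (phi, tau), E|theta_j| = phi_j tau, and the phi_j sum to 1,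
    so E||theta||_1 = E tau = 1/lambda whatever n is. Since t_n tends to infinity
    and dominates ||theta0||_2 = sqrt (c log n), Markov's inequality already gives
    P(||theta - theta0||_2 < t_n) >= 1/2 for large n, so C = 1 works. *)

(** * Exponential integrals and Laplace tails *)

Lemma integral_expRN_itvcy (R : realType) (k t : R) : 0 < k ->
  (\int[lebesgue_measure]_(x in `[t, +oo[) (expR (- (k * x)))%:E
   = (k^-1 * expR (- (k * t)))%:E)%E.
Proof.
move=> k0.
have cE : continuous (fun x : R => expR (- (k * x))).
  move=> x; apply: continuous_comp; last exact: continuous_expR.
  by apply: cvgN; exact: mulrl_continuous.
have dF (x : R) : is_derive x 1 (fun y : R => - (k^-1 * expR (- (k * y))))
    (expR (- (k * x))).
  apply: is_derive_eq.
  by rewrite /GRing.scale/= mulr1 !mulrN opprK mulrCA mulVf ?mulr1 ?gt_eqF.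
rewrite (@ge0_continuous_FTC2y _ _ (fun x => - (k^-1 * expR (- (k * x)))) _ 0).
- by rewrite add0e -EFinN opprK.
- by move=> x _; exact: expR_ge0.
- exact: continuous_subspaceT.
- rewrite -oppr0; apply: cvgN; rewrite -(mulr0 k^-1); apply: cvgMr.
  apply: (@cvg_comp _ _ _ (fun x => k * x) (fun z => expR (- z)) _ (pinfty_nbhs R)).
    exact: gt0_cvgMry.
  exact: cvgr_expR.
- by move=> x _; exact: ex_derive.
- by apply: cvg_at_right_filter; apply: cvgN; apply: cvgMr; exact: cE.
- by move=> x _; rewrite derive1E derive_val.
Qed.

(* The half-open/closed mix makes the set all of [R] at [t = 0]. *)
Lemma laplace_prob_tail (R : realType) (sigma t : R) : 0 < sigma -> 0 <= t ->
  laplace_prob sigma (`]-oo, - t[ `|` `[t, +oo[) = (expR (- (t / sigma)))%:E.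
Proof.
move=> s0 t0; rewrite /laplace_prob.
have mpdf : measurable_fun [set: R] (EFin \o laplace_pdf sigma).
  apply/measurable_EFinP/measurable_funM => //.
  apply: measurableT_comp => //; apply: measurable_funM => //.
  by apply: measurableT_comp => //; exact: measurableT_comp.
have pdf_ge0 y : (0 <= (laplace_pdf sigma y)%:E)%E.
  by rewrite lee_fin mulr_ge0 ?expR_ge0// invr_ge0 mulr_ge0// ltW.
have half : (\int[lebesgue_measure]_(y in `[t, +oo[) (laplace_pdf sigma y)%:E
    = (2^-1 * expR (- (t / sigma)))%:E)%E.
  under eq_integral => y.
    rewrite inE/= in_itv/= andbT => ty.
    rewrite /laplace_pdf (ger0_norm (le_trans t0 ty)) mulNr (mulrC y) EFinM.
    over.
  rewrite ge0_integralZl//=; first last.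
  - by rewrite lee_fin invr_ge0 mulr_ge0// ltW.
  - apply/measurable_EFinP/measurableT_comp => //.
    by apply: measurableT_comp => //; exact: measurable_funM.
  rewrite integral_expRN_itvcy ?invr_gt0// -EFinM; congr EFin.
  by rewrite invrK mulrA invfM mulfVK ?gt_eqF// (mulrC t).
have half' : (\int[lebesgue_measure]_(y in `]-oo, (- t)%R[) (laplace_pdf sigma y)%:E
    = (2^-1 * expR (- (t / sigma)))%:E)%E.
  (* The density is even, so the left half follows from the right one by [y -> - y]. Closing the
     endpoint first costs only a null set. *)
  rewrite integral_itv_bndo_bndc; last exact: measurable_funTS.
  rewrite ge0_integration_by_substitutionNy.
  - by rewrite -half; apply: eq_integral => y _; rewrite /laplace_pdf/= normrN.
  - apply: continuous_subspaceT => y; apply: cvgMr.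
    apply: continuous_comp; last exact: continuous_expR.
    by apply: cvgMl; apply: cvgN; exact: norm_continuous.
  - by move=> y _; move: (pdf_ge0 y); rewrite lee_fin.
rewrite ge0_integral_setU//=.
- by rewrite half half' -EFinD -mulrDl -(div1r 2) -splitr mul1r.
- exact: measurable_funTS.
- apply/disj_setPS => y [] /=; rewrite !in_itv/= andbT => yt ty.
  by have := le_lt_trans ty yt; rewrite ltNge (le_trans _ t0) ?oppr_le0.
Qed.

(** * Expectations bounded through exponential tails *)

(* Layer-cake formula and Tonelli: [\int_0^oo exp (- t / s) dt = s]. *)
Lemma ge0_expectation_le_exp_tail d (T : measurableType d) (R : realType)
    (P : probability T R) (X s : T -> R) (G : set T) :
  measurable_fun setT X -> (forall w, 0 <= X w) ->
  measurable G -> measurable_fun setT s -> (forall w, G w -> 0 < s w) ->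
  (forall t, 0 <= t -> (P [set w | (t < X w)%R]
     <= \int[P]_(w in G) (expR (- (t / s w)))%:E)%E) ->
  (\int[P]_w (X w)%:E <= \int[P]_(w in G) (s w)%:E)%E.
Proof.
move=> mX X0 mG ms s_gt0 tailX.
pose Y : {mfun T >-> R} := HB.pack X (isMeasurableFun.Build _ _ _ _ X mX).
pose mu : {sigma_finite_measure set (measurableTypeR R) -> \bar R} :=
  @lebesgue_measure R.
pose D : set R := `[0%R, +oo[%classic.
have mD : measurable (D : set (measurableTypeR R)) by exact: measurable_itv.
pose f (p : measurableTypeR R * T) := ((expR (- (p.1 / s p.2)))%:E).
(* Extending [f] by zero allows Tonelli on the whole product, although [s] is controlled only on
   [G]. *)
pose g := f \_ (D `*` G).
have mf : measurable_fun (D `*` G) f.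
  (* [`^ (-1)] is measurable on all of [R] and is the inverse where [s > 0]. *)
  have mV : measurable_fun setT
      (fun p : measurableTypeR R * T => expR (- (p.1 * s p.2 `^ (-1)))).
    apply: measurableT_comp => //; apply: measurableT_comp => //.
    apply: measurable_funM => //.
    apply: (measurableT_comp (measurable_powR _)).
    exact: measurableT_comp.
  apply/measurable_EFinP.
  apply: eq_measurable_fun (measurable_funTS mV) => p /[!inE]-[_ Gp].
  by rewrite powR_inv1 ?ltW ?s_gt0.
have mg : measurable_fun setT g.
  have mDG : measurable (D `*` G) by exact: measurableX.
  exact: (measurable_restrictT f mDG).1 mf.
have g0 p : (0 <= g p)%E.
  by rewrite /g patchE; case: ifP => // _; rewrite lee_fin expR_ge0.
have gE t w : g (t, w) = if (t \in D) && (w \in G) then f (t, w) else 0%E.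
  by rewrite /g patchE in_setX.
have ccdfE t : ccdf (Y : {RV P >-> R}) t = P [set w | (t < X w)%R].
  rewrite /ccdf /distribution/= /pushforward; congr (P _).
  by apply/seteqP; split => w /=; rewrite in_itv/= andbT.
have mtail : measurable_fun setT (fun t : measurableTypeR R => P [set w | (t < X w)%R]).
  by rewrite -(funext ccdfE); exact: ccdf_measurable.
have -> : (\int[P]_w (X w)%:E = \int[mu]_(t in D) P [set w | (t < X w)%R])%E.
  have := @ge0_expectation_ccdf _ _ _ P Y X0.
  rewrite expectation_def => ->; apply: eq_integral => t _.
  exact: ccdfE.
have tE t : D t -> (\int[P]_w g (t, w) =
    \int[P]_(w in G) (expR (- (t / s w)))%:E)%E.
  move=> Dt; rewrite [RHS]integral_mkcond; apply: eq_integral => w _.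
  by rewrite gE patchE mem_set.
(* For fixed [w] in [G], integrating [exp (- t / s w)] over [t >= 0] returns [s w]. Once the two
   integrals are swapped, the tail hypothesis can be compared pointwise in [t]. *)
have -> : (\int[P]_(w in G) (s w)%:E = \int[P]_w \int[mu]_t g (t, w))%E.
  rewrite integral_mkcond; apply: eq_integral => w _; rewrite patchE.
  case: ifPn => [/[!inE] Gw|Gw]; last first.
    by rewrite integral0_eq// => t _; rewrite gE (negbTE Gw) andbF.
  transitivity (\int[mu]_(t in D) (expR (- ((s w)^-1 * t)))%:E)%E.
    by rewrite integral_expRN_itvcy ?invr_gt0 ?s_gt0// mulr0 oppr0 expR0 mulr1 invrK.
  rewrite [LHS]integral_mkcond; apply: eq_integral => t _.
  by rewrite gE patchE (mem_set Gw) andbT /f mulrC.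
rewrite -fubini_tonelli//.
rewrite integral_mkcond; apply: ge0_le_integral => //.
- by move=> t _; rewrite patchE; case: ifP.
- exact: (measurable_restrictT _ mD).1 (measurable_funTS mtail).
- exact: measurable_fun_fubini_tonelli_F.
- move=> t _; rewrite patchE; case: ifPn => [/[!inE] Dt|_].
    by rewrite tE// tailX//; move: Dt; rewrite /D/= in_itv/= andbT.
  exact: integral_ge0.
Qed.

Lemma exponential_prob_tail (R : realType) (lambda t : R) : 0 < lambda -> 0 <= t ->
  exponential_prob lambda `]t, +oo[ = (expR (- (lambda * t)))%:E.
Proof.
move=> l0 t0; rewrite /exponential_prob integral_itv_obnd_cbnd; last first.
  by apply/measurable_EFinP/measurable_funTS; exact: measurable_exponential_pdf.
under eq_integral => y.
  rewrite inE/= in_itv/= andbT => ty.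
  rewrite exponential_pdfE ?(le_trans t0)// mulNr EFinM.
  over.
rewrite ge0_integralZl//=; first last.
- by rewrite lee_fin ltW.
- apply/measurable_EFinP/measurableT_comp => //.
  by apply: measurableT_comp => //; exact: measurable_funM.
by rewrite integral_expRN_itvcy// -EFinM mulVKf ?gt_eqF.
Qed.

(** The tail [exp (- lambda t)] is the constant case [s = 1 / lambda] of the previous comparison.
    The maximum with 0 supplies nonnegativity at every point, whereas [tau] is positive only almost
    surely. *)
Lemma exponential_expectation_le d (T : measurableType d) (R : realType)
    (P : probability T R) (lambda : R) (tau : {RV P >-> R}) : 0 < lambda ->
  (forall S, measurable S -> distribution P tau S = exponential_prob lambda S) ->
  (\int[P]_w (Num.max (tau w) 0)%:E <= (lambda^-1)%:E)%E.
Proof.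
move=> l0 tauE.
have int_cst c : (\int[P]_(w in setT) c%:E = c%:E)%E.
  rewrite integral_cst// -[RHS]mule1; congr (_ * _)%E; exact: probability_setT.
rewrite -[leRHS]int_cst.
apply: (@ge0_expectation_le_exp_tail _ _ _ P _ (fun=> lambda^-1) setT) => //.
- exact: measurable_maxr.
- by move=> w; rewrite le_max lexx orbT.
- by move=> w _; rewrite invr_gt0.
move=> t t0; rewrite int_cst invrK mulrC.
(* Since [t >= 0], the maximum exceeds [t] exactly when [tau] does. *)
rewrite -exponential_prob_tail// -tauE// le_eqVlt; apply/orP; left; apply/eqP.
rewrite /distribution/= /pushforward; congr (P _).
apply/seteqP; split => w /=; rewrite in_itv/= andbT lt_max.
  by case/orP => // /(le_lt_trans t0); rewrite ltxx.
by move=> ->.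
Qed.

(** * Almost sure positivity of the Dirichlet weights *)

(* The junk value [0 `^ x = 0] for [x != 0] kills the density on the faces
   [p_j = 0]. *)
Lemma dirichlet_prob_not_pos (R : realType) (n : nat) (a : R) : a != 1 ->
  dirichlet_prob a (~` [set p : n.-tuple R | prob_simplex p /\
    forall j, 0 < tnth p j]) = 0%E.
Proof.
move=> a1; rewrite /dirichlet_prob integral0_eq// => x [spx] /= npos.
have [j] : exists j, ~ 0 < tnth (hyperplane_point x) j.
  by apply/existsNP => pos; exact: npos (conj spx pos).
move/negP; rewrite -leNgt => pj_le0.
have pj0 : tnth (hyperplane_point x) j = 0.
  by apply/eqP; rewrite eq_le pj_le0 spx.1.
rewrite /dirichlet_pdf (bigD1 j)//= pj0 powR0 ?mul0r ?mulr0//.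
by rewrite subr_eq0.
Qed.

Lemma measurable_pos_simplex (R : realType) (n : nat) :
  measurable [set p : n.-tuple R | prob_simplex p /\ forall j, 0 < tnth p j].
Proof.
have -> : [set p : n.-tuple R | prob_simplex p /\ forall j, 0 < tnth p j] =
    (fun p => \sum_(j < n) tnth p j) @^-1` [set 1] `&`
    \bigcap_(j in [set: 'I_n]) ((@tnth n R ^~ j) @^-1` `]0, +oo[).
  apply/seteqP; split=> p /=.
    case=> -[_ p1] p0; split=> // j _ /=.
    by rewrite in_itv/= p0.
  case=> p1 p0; have {}p0 j : 0 < tnth p j.
    by have := p0 j I; rewrite /= in_itv/= andbT.
  by split=> //; split=> // j; exact: ltW.
apply: measurableI.
  rewrite -[X in measurable X]setTI; apply: measurable_sum => // j.
  exact: measurable_tnth.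
apply: fin_bigcap_measurable => // j _.
by rewrite -[X in measurable X]setTI; apply: measurable_tnth.
Qed.

(** * Expected l1 norm under the hierarchy *)

Section hierarchy.
Context d (T : measurableType d) (R : realType) (P : probability T R) (n : nat).
Variables (a lambda : R) (theta phi : {RV P >-> n.-tuple R}) (tau : {RV P >-> R}).
Hypotheses (a1 : a != 1) (lambda0 : 0 < lambda).
Hypothesis DL : DL_hierarchy a lambda theta phi tau.

(** Here every Laplace scale is positive, so the tail formula applies, and the weights sum to 1. It
    is a set of pairs [(phi, tau)] so that it can serve as the conditioning event [G] in
    [conditionally_laplace]. *)
Let pos_scales : set (n.-tuple R * R) :=
  [set p | prob_simplex p /\ forall j, 0 < tnth p j] `*` `]0, +oo[.

Let good : set T := [set w | pos_scales (phi w, tau w)].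

Let measurable_pos_scales : measurable pos_scales.
Proof. by apply: measurableX => //; exact: measurable_pos_simplex. Qed.

Let measurable_good : measurable good.
Proof.
rewrite -[X in measurable X]setTI.
by apply: (measurable_fun_pair (f := phi) (g := tau)).
Qed.

Let measurable_coord j : measurable_fun setT (fun w => tnth (theta w) j).
Proof. exact: (measurableT_comp (measurable_tnth j)). Qed.

Let measurable_scale j : measurable_fun setT (fun w => tnth (phi w) j * tau w).
Proof.
apply: measurable_funM => //.
exact: (measurableT_comp (measurable_tnth j)).
Qed.

Let scale_gt0 j w : good w -> 0 < tnth (phi w) j * tau w.
Proof.
case=> /= -[_ pos]; rewrite in_itv/= andbT => tau0.
exact: mulr_gt0.
Qed.

(** Union bound: the Dirichlet density vanishes on the faces of the simplex, and the exponential
    tail at 0 gives [tau > 0] mass 1. *)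
Let not_good0 : P (~` good) = 0%E.
Proof.
case: DL => tauE phiE _ _.
pose phi_bad := phi @^-1` (~` [set p | prob_simplex p /\ forall j, 0 < tnth p j]).
pose tau_bad := tau @^-1` (~` `]0, +oo[).
have mphi : measurable phi_bad.
  by apply: measurable_funPTI; apply: measurableC; exact: measurable_pos_simplex.
have mtau : measurable tau_bad.
  by apply: measurable_funPTI; exact: measurableC.
have phi0 : P phi_bad = 0%E.
  rewrite -(@dirichlet_prob_not_pos R n a)// -phiE//.
  by apply: measurableC; exact: measurable_pos_simplex.
have tau0 : P tau_bad = 0%E.
  have mtau' : measurable (tau @^-1` `]0, +oo[) by exact: measurable_funPTI.
  rewrite [LHS](probability_setC P mtau').
  have := tauE _ (measurable_itv `]0%R, +oo[).
  rewrite exponential_prob_tail// mulr0 oppr0 expR0 => tau_pos.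
  by rewrite [X in (_ - X)%E]tau_pos subee.
apply/eqP; rewrite -measure_le0.
apply: (@le_trans _ _ (P (phi_bad `|` tau_bad))).
  apply: le_measure; rewrite ?inE.
  - exact: measurableC.
  - exact: measurableU.
  - by move=> w /not_andP[] ?; [left|right].
rewrite (le_trans (measureU2 _ mphi mtau))//.
by rewrite [X in (X + _)%E]phi0 [X in (_ + X)%E]tau0 adde0.
Qed.

(** Conditioning on [(phi, tau)] within [good] with a test event that constrains only coordinate [j]
    leaves one Laplace tail; the other factors are total masses. *)
Let coord_tail j t : 0 <= t ->
  (P [set w | (t < `|tnth (theta w) j|)%R] <=
   \int[P]_(w in good) (expR (- (t / (tnth (phi w) j * tau w))))%:E)%E.
Proof.
move=> t0; case: DL => _ _ _ condE.
pose U : set R := `]-oo, - t[ `|` `[t, +oo[.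
pose A (i : 'I_n) : set R := if i == j then U else setT.
have mU : measurable U by exact: measurableU.
have mA i : measurable (A i) by rewrite /A; case: ifP.
pose event := [set w | forall i, A i (tnth (theta w) i)].
have eventE : event = (fun w => tnth (theta w) j) @^-1` U.
  apply/seteqP; split => w /=; first by move/(_ j); rewrite /A eqxx.
  by move=> Uw i; rewrite /A; case: eqP => [->|].
have mevent : measurable event.
  by rewrite eventE -[X in measurable X]setTI; exact: measurable_coord.
(* The conditional law is applied on [good] only; its complement is added as a null set. *)
apply: (@le_trans _ _ (P ((event `&` good) `|` ~` good))).
  apply: le_measure; rewrite ?inE.
  - have mnorm : measurable_fun setT (fun w => `|tnth (theta w) j|).
      exact: measurableT_comp.
    by have := mnorm measurableT _ (measurable_itv `]t, +oo[); rewrite setTI set_itvoy.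
  - apply: measurableU; last exact: measurableC.
    exact: measurableI.
  - move=> w tw; have [gw|] := pselect (good w); last by right.
    left; split=> //; rewrite eventE /U/= !in_itv/= andbT.
    by move: tw => /=; rewrite ltr_normr => /orP[/ltW|]; [right|left; rewrite ltrNr].
apply: (le_trans (measureU2 _ (measurableI _ _ mevent measurable_good)
  (measurableC measurable_good))).
rewrite [X in (_ + X)%E]not_good0 adde0.
rewrite [leLHS](condE A pos_scales)// le_eqVlt; apply/predU1P; left.
apply: eq_integral => w /[!inE] gw.
rewrite (bigD1 j)//= {1}/A eqxx laplace_prob_tail ?scale_gt0// big1 ?mule1//.
move=> i /negbTE ij; rewrite /A ij.
(* The tail formula at [t = 0] shows that each unconstrained factor is 1. *)
have -> : [set: R] = `]-oo, - 0[ `|` `[0, +oo[.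
  apply/seteqP; split=> // y _ /=.
  by rewrite !in_itv/= andbT oppr0; case: ltP; [left|right].
by rewrite laplace_prob_tail ?scale_gt0// mul0r oppr0 expR0.
Qed.

(** Each coordinate has expected absolute value at most the integral of [phi_j * tau] over [good].
    Summing before integrating removes the weights, which makes the bound independent of [n]. *)
Lemma DL_expectation_norm1_le :
  (\int[P]_w (\sum_(j < n) `|tnth (theta w) j|)%:E <= (lambda^-1)%:E)%E.
Proof.
case: DL => tauE _ _ _.
apply: le_trans (exponential_expectation_le lambda0 tauE).
under eq_integral do rewrite -sumEFin.
rewrite ge0_integral_sum//; last first.
  by move=> j; apply/measurable_EFinP; exact: measurableT_comp.
apply: (@le_trans _ _
  (\sum_(j < n) \int[P]_(w in good) (tnth (phi w) j * tau w)%:E)%E).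
  apply: lee_sum => j _; apply: ge0_expectation_le_exp_tail => //.
  - exact: measurableT_comp.
  - by move=> w; exact: scale_gt0.
  - exact: coord_tail.
rewrite -ge0_integral_sum//; last 2 first.
- by move=> j; apply/measurable_EFinP/measurable_funTS.
- by move=> j w gw; rewrite lee_fin ltW// scale_gt0.
have mmax : measurable_fun setT (fun w => (Num.max (tau w) 0)%:E).
  by apply/measurable_EFinP; exact: measurable_maxr.
have max_ge0 w : (0 <= (Num.max (tau w) 0)%:E)%E.
  by rewrite lee_fin le_max lexx orbT.
apply: (@le_trans _ _ (\int[P]_(w in good) (Num.max (tau w) 0)%:E)%E).
  rewrite le_eqVlt; apply/predU1P; left.
  apply: eq_integral => w /[!inE] -[/= -[[_ sum1] _]].
  rewrite in_itv/= andbT => tau0.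
  by rewrite sumEFin -mulr_suml sum1 mul1r max_l// ltW.
by apply: ge0_subset_integral.
Qed.
End hierarchy.

(** * From the l1 bound to the Euclidean ball *)

(** Combine [(x - y)^2 <= 2 x^2 + 2 y^2] with the domination of the l2 norm by the l1 norm: each of
    the two sums contributes at most [t^2 / 2], the first one strictly less. *)
Lemma sum_sqr_sub_lt (R : realFieldType) (n : nat) (x y : 'I_n -> R) (t : R) :
  \sum_(j < n) `|x j| < t / 2 -> 4 * \sum_(j < n) y j ^+ 2 <= t ^+ 2 ->
  \sum_(j < n) (x j - y j) ^+ 2 < t ^+ 2.
Proof.
set S := \sum_(j < n) `|x j| => St yt.
have S0 : 0 <= S by apply: sumr_ge0.
have x2S : \sum_(j < n) x j ^+ 2 <= S ^+ 2.
  rewrite expr2 {1}/S mulr_suml; apply: ler_sum => j _.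
  rewrite -real_normK ?num_real// expr2 ler_wpM2l//.
  by rewrite /S (bigD1 j)//= lerDl sumr_ge0.
have S2 : S ^+ 2 < (t / 2) ^+ 2 by rewrite ltr_pXn2r// nnegrE (le_trans S0)// ltW.
have : \sum_(j < n) (x j - y j) ^+ 2 <=
    2 * \sum_(j < n) x j ^+ 2 + 2 * \sum_(j < n) y j ^+ 2.
  rewrite !mulr_sumr -big_split/=; apply: ler_sum => j _.
  (* The slack is exactly [(x j + y j)^2]. *)
  have := sqr_ge0 (x j + y j); nra.
have e : t ^+ 2 = 4 * (t / 2) ^+ 2 by field.
by move: yt S2 x2S; rewrite e; lra.
Qed.

Lemma DL_norm1_tail d (T : measurableType d) (R : realType) (P : probability T R)
    (n : nat) (a lambda u : R) (theta phi : {RV P >-> n.-tuple R})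
    (tau : {RV P >-> R}) : a != 1 -> 0 < lambda -> 0 < u ->
  DL_hierarchy a lambda theta phi tau ->
  (P [set w | (u <= \sum_(j < n) `|tnth (theta w) j|)%R]
   <= ((lambda * u)^-1)%:E)%E.
Proof.
move=> a1 l0 u0 DL.
pose S w : R := \sum_(j < n) `|tnth (theta w) j|.
have mS : measurable_fun setT S.
  apply: measurable_sum => j; apply: measurableT_comp => //.
  exact: (measurableT_comp (measurable_tnth j)).
have S0 w : 0 <= S w by exact: sumr_ge0.
(* Markov's inequality, as the case of the identity in its version for monotone functions. *)
have := @le_integral_comp_abse _ _ _ P setT measurableT (EFin \o S) u id.
move=> /(_ (@measurable_id _ _ _) (fun _ r0 => r0) (fun _ _ _ _ xy => xy)) /=.
move=> /(_ _ u0); rewrite setTI => /(_ _)/wrap[]; first exact/measurable_EFinP.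
have -> : [set w | (u%:E <= `|S w|%:E)%E] =
    [set w | u <= \sum_(j < n) `|tnth (theta w) j|].
  by apply: eq_set => w; rewrite lee_fin ger0_norm.
under eq_integral do rewrite ger0_norm//.
move=> /le_trans/(_ (DL_expectation_norm1_le a1 l0 DL)).
by rewrite invfM EFinM -lee_pdivlMl// muleC.
Qed.

Theorem theorem4p1 (R : realType) (delta lambda : R)
    (hdelta0 : 0 < delta) (hdelta1 : delta < 1) (hlambda : 0 < lambda) :
  exists2 C : R, 0 < C &
  forall c : R, exists N : nat, forall n : nat, (N <= n)%N ->
  forall (d : measure_display) (T : measurableType d) (P : probability T R)
    (theta : {RV P >-> n.-tuple R}) (theta0 : n.-tuple R),
    DL_distributed (n%:R^-1) lambda theta ->
    (exists! j : 'I_n, tnth theta0 j != 0) ->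
    norm2 (tnth theta0) ^+ 2 = c * ln n%:R ->
    ((expR (- C * Num.sqrt (ln n%:R)))%:E <=
     P [set w | (norm2 (fun j => tnth (theta w) j - tnth theta0 j)
                < n%:R `^ (delta / 2))%R])%E.
Proof.
exists 1 => // c.
(* Once [t >= K], the first term gives [4 ||theta0||^2 <= t^2] and the second makes the Markov bound
   [2 / (lambda t)] at most 1/2. *)
pose K := Num.max (8 * `|c| / delta) (4 / lambda).
have K0 : 0 < K by rewrite lt_max orbC divr_gt0.
(* The summand [expR 1] forces [ln n >= 1]; the power of [K] inverts [n -> n^(delta/2)] and forces
   [t >= K]. The threshold may depend on [c], while [C = 1] does not. *)
exists (Num.truncn (expR 1 + K `^ (2 / delta))).+1 => n Nn d T P theta theta0.
move=> [d' [T' [P' [theta' [phi [tau [DL thetaE]]]]]]] _ theta0E.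
have n_gt : expR 1 + K `^ (2 / delta) < n%:R.
  by apply: lt_le_trans (truncnS_gt _) _; rewrite ler_nat.
have n_gte : expR 1 < n%:R :> R by apply: le_lt_trans n_gt; rewrite lerDl powR_ge0.
have n0 : 0 < n%:R :> R by apply: lt_trans n_gte; exact: expR_gt0.
set t := n%:R `^ (delta / 2).
have t0 : 0 < t by exact: powR_gt0.
have Kt : K <= t.
  have -> : K = (K `^ (2 / delta)) `^ (delta / 2).
    rewrite -powRrM (_ : _ * _ = 1) ?powRr1 ?ltW//.
    by field; rewrite gt_eqF.
  apply: ge0_ler_powR; rewrite ?nnegrE ?powR_ge0 ?divr_ge0// ltW//.
  by apply: le_lt_trans n_gt; rewrite lerDr expR_ge0.
have theta0t : 4 * \sum_(j < n) tnth theta0 j ^+ 2 <= t ^+ 2.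
  have -> : \sum_(j < n) tnth theta0 j ^+ 2 = c * ln n%:R.
    by rewrite -theta0E sqr_sqrtr// sumr_ge0// => j _; exact: sqr_ge0.
  (* With [ln t <= t] this gives [4 |c| ln n <= (8 |c| / delta) t <= t^2]. *)
  have lnn : ln n%:R = 2 / delta * ln t.
    by rewrite /t ln_powR; field; rewrite gt_eqF.
  have lnt : ln t <= t.
    have : ln (1 + (t - 1)) <= t - 1 by apply: le_ln1Dx; lra.
    by rewrite subrKC; lra.
  have lnn0 : 0 <= ln n%:R :> R.
    by rewrite ln_ge0// (le_trans _ (ltW n_gte))// ltW// expR_gt1.
  have ct : 8 * `|c| / delta <= t by apply: le_trans Kt; rewrite le_max lexx.
  apply: (@le_trans _ _ (8 * `|c| / delta * t)); last first.
    by rewrite expr2 ler_wpM2r// ltW.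
  apply: (@le_trans _ _ (4 * (`|c| * ln n%:R))).
    by rewrite ler_wpM2l// ler_wpM2r// ler_norm.
  rewrite lnn (_ : 4 * _ = 8 * `|c| / delta * ln t); last by field; rewrite gt_eqF.
  by rewrite ler_wpM2l// divr_ge0 ?mulr_ge0// ltW.
(* Writing the ball as a set of tuples lets the equality of laws move the event to the space
   carrying the hierarchy. *)
pose B := [set x : n.-tuple R | \sum_(j < n) (tnth x j - tnth theta0 j) ^+ 2 < t ^+ 2].
have mB : measurable B.
  have mq : measurable_fun setT
      (fun x : n.-tuple R => \sum_(j < n) (tnth x j - tnth theta0 j) ^+ 2).
    apply: measurable_sum => j; apply: measurable_funX; apply: measurable_funB => //.
    exact: measurable_tnth.
  by have := mq measurableT _ (measurable_itv `]-oo, t ^+ 2[); rewrite setTI set_itvNyo.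
rewrite [leRHS](_ : _ = distribution P theta B); last first.
  congr (P _); apply: eq_set => w.
  rewrite -{1}(ger0_norm (ltW t0)) -sqrtr_sqr ltr_sqrt ?exprn_gt0//.
rewrite thetaE//.
pose S w : R := \sum_(j < n) `|tnth (theta' w) j|.
have mS : measurable_fun setT S.
  apply: measurable_sum => j; apply: measurableT_comp => //.
  exact: (measurableT_comp (measurable_tnth j)).
have mSt : measurable [set w | t / 2 <= S w].
  by have := mS measurableT _ (measurable_itv `[t / 2, +oo[); rewrite setTI set_itvcy.
(* The Dirichlet parameter differs from 1, so its density vanishes on the faces. *)
have n1 : n%:R^-1 != 1 :> R.
  rewrite invr_eq1 gt_eqF// (le_lt_trans _ n_gte)// ltW//.
  by rewrite expR_gt1.
have tail := DL_norm1_tail n1 hlambda (divr_gt0 t0 (ltr0n _ 2)) DL.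
apply: (@le_trans _ _ (P' (~` [set w | t / 2 <= S w]))); last first.
  apply: le_measure; rewrite ?inE; first exact: measurableC.
    by apply: measurable_funPTI.
  move=> w /= /negP; rewrite -ltNge => Sw.
  exact: sum_sqr_sub_lt.
rewrite probability_setC//.
(* The value 1/2 separates the two sides: [exp (sqrt (ln n)) >= 1 + sqrt (ln n) >= 2], while the
   Markov event has probability at most 1/2. *)
apply: (@le_trans _ _ (2^-1)%:E).
  rewrite lee_fin mulN1r expRN lef_pV2 ?posrE ?expR_gt0//.
  apply: le_trans (expR_ge1Dx _); rewrite -[leLHS]/(1 + 1) lerD2l -[leLHS]sqrtr1.
  rewrite ler_wsqrtr// -[leLHS]expRK ler_ln ?posrE ?expR_gt0// ltW//.
rewrite leeBrDr ?fin_num_measure//.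
apply: (@le_trans _ _ ((2^-1)%:E + ((lambda * (t / 2))^-1)%:E)%E).
  by rewrite leeD2l.
rewrite -EFinD lee_fin [leRHS]splitr div1r lerD2l lef_pV2 ?posrE ?mulr_gt0//.
have : 4 / lambda <= t by apply: le_trans Kt; rewrite le_max lexx orbT.
by rewrite ler_pdivrMr//; lra.
Qed.
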